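(* Let $S$ be any fixed subset of $\{-1,0,1\}^n$ that is stable under each of the $n$ reflections negating a single coordinate. Within the set of walks on $\mathbb{Z}^n$ starting at the origin and with steps in $S$, there is a length preserving bijection from the walks that end in a point of $\{0,1\}^n$ to the walks that remain at all times inside the (weakly) positive orthant $\mathbb{N}^n$, where $\mathbb{N}=\{0,1,2,\dots\}$. It is defined by applying the one-dimensional map $\Phi$ (described in the context) to each coordinate separately: a walk $w$ with steps $s_1,\dots,s_l\in S$ is sent to the walk whose sequence of $i$-th coordinates of steps is, for each $i=1,\dots,n$, the image under $\Phi$ of the sequence of $i$-th coordinates of $s_1,\dots,s_l$.
   Context: A walk of length $l$ on $\mathbb{Z}^n$ starting at the origin with steps in $S$ is given by a sequence $(s_1,\dots,s_l)\in S^l$; its positions are $p_0=0$ and $p_k=s_1+\cdots+s_k$ for $1\le k\le l$, and it ends at $p_l$. The one-dimensional map $\Phi$: let $w$ be a walk on $\mathbb{Z}$ starting at $0$, with steps in $\{-1,0,1\}$, ending at $0$ or $1$, and let $-d$ (with $d\ge0$) be the minimal number it visits. For each $j=1,\dots,d$ there is a unique down-step (step $-1$) of $w$ that first reaches the number $-j$. Then $\Phi(w)$ is obtained from $w$ by changing these $d$ down-steps into up-steps (steps $+1$), all other steps being unchanged. For a walk on $\mathbb{Z}^n$ with steps in $S\subseteq\{-1,0,1\}^n$, the sequence of $i$-th coordinates of its steps is regarded as a walk on $\mathbb{Z}$ starting at $0$ with steps in $\{-1,0,1\}$. *)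

(* Defs.v *)
From mathcomp Require Import all_boot all_order all_algebra.
From mathcomp Require Import classical_sets functions.

Set Implicit Arguments.
Unset Strict Implicit.
Unset Printing Implicit Defensive.

Import Order.TTheory GRing.Theory Num.Theory.
Local Open Scope classical_set_scope.
Local Open Scope ring_scope.

(* A walk starting at the origin is the sequence of its steps; [position w k]
   is p_k = s_1 + ... + s_k. *)
Definition position (V : zmodType) (w : seq V) (k : nat) : V :=
  \sum_(s <- take k w) s.

Definition positions (V : zmodType) (w : seq V) : seq V :=
  mkseq (position w) (size w).+1.

Definition endpoint (V : zmodType) (w : seq V) : V := position w (size w).

(* The minimal position is <= 0 because p_0 = 0, so taking 0 as the default of
   the iterated minimum is harmless and the absolute value is its opposite. *)
Definition depth (w : seq int) : nat :=
  absz (\big[Order.min/0]_(p <- positions w) p).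

(* Steps are numbered from 0: step k leads from p_k to p_(k+1), and
   [take k.+1 (positions w)] lists p_0, ..., p_k. *)
Definition is_first_down_step (w : seq int) (j k : nat) : bool :=
  [&& w`_k == -1, position w k.+1 == - j%:Z
    & - j%:Z \notin take k.+1 (positions w)].

(* Total on all integer sequences; only meaningful for walks with steps in
   {-1, 0, 1} (ending at 0 or 1). *)
Definition Phi (w : seq int) : seq int :=
  mkseq (fun k => if has (fun j => is_first_down_step w j k)
                         (iota 1 (depth w))
                  then 1 else w`_k)
        (size w).

Definition coord_walk (n : nat) (i : 'I_n) (w : seq 'rV[int]_n) : seq int :=
  [seq s ord0 i | s : 'rV[int]_n <- w].

Definition Phi_coordwise (n : nat) (w : seq 'rV[int]_n) : seq 'rV[int]_n :=
  mkseq (fun k => \row_(i < n) (Phi (coord_walk i w))`_k) (size w).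

Definition reflection (n : nat) (i : 'I_n) (s : 'rV[int]_n) : 'rV[int]_n :=
  \row_(j < n) (if j == i then - s ord0 j else s ord0 j).

Definition small_steps (n : nat) : set 'rV[int]_n :=
  [set s | forall i, s ord0 i \in [:: -1; 0; 1]].
Arguments small_steps n : clear implicits.

Definition walks (n : nat) (S : set 'rV[int]_n) : set (seq 'rV[int]_n) :=
  [set w | forall s, s \in w -> S s].

Definition walks_ending_in_01 (n : nat) (S : set 'rV[int]_n) :
    set (seq 'rV[int]_n) :=
  [set w | walks S w /\ forall i, endpoint w ord0 i \in [:: 0; 1]].

Definition walks_in_orthant (n : nat) (S : set 'rV[int]_n) :
    set (seq 'rV[int]_n) :=
  [set w | walks S w /\ forall p, p \in positions w -> forall i, 0 <= p ord0 i].

(* Main.v *)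
Require Import Defs.
From mathcomp Require Import all_boot all_order all_algebra.
From mathcomp Require Import classical_sets functions.
From mathcomp Require Import zify.

Set Implicit Arguments.
Unset Strict Implicit.
Unset Printing Implicit Defensive.

Import Order.TTheory GRing.Theory Num.Theory.
Local Open Scope classical_set_scope.
Local Open Scope ring_scope.

(**
Let p be the position of a one-dimensional walk w, -m its running minimum and
F = p + m >= 0 its height above that minimum.  A down-step reaches a new
minimum exactly when F = 0, so Phi turns down-steps into up-steps precisely
where the height, updated by F <- max 0 (F + s), would become negative
([Phi_reflect]).  The image of w is thus produced by a machine with state F,
and its position is p + 2m = 2F - p ([sum_reflect]), which is nonnegative
because F >= p and F >= 0.

The machine is reversible: after a step s has been turned into t and the
height F into F', feeding - t to the machine in state F' outputs - s and
restores F ([reflect_stepK]).  Hence running it on the time reversal of the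
image, starting from the final height, gives back the time reversal of w
([reflect_time_reversal]).

The final height can be read off the image: if w ends at p in {0, 1}, the image
ends at e = 2F - p, so F is e / 2 rounded up, and Phi is injective.
Conversely, let v be a nonnegative walk ending at e, and run the machine
backwards on v from this height F <= e.  The height stays below the position
of v, so that it is 0 at time 0 ([level_time_reversal_le]): the result is a
walk whose image by Phi is v, and which ends at 2F - e in {0, 1}.

In dimension n all this is done in each coordinate separately.  Both Phi and
its inverse only change signs of steps, and a set that is stable under the
reflections contains with a step all those that differ from it by signs of
coordinates ([stable_norm]).
*)

(** * Reflection at zero and its time reversal *)

Section OneDimension.
Implicit Types (h s : int) (u v w : seq int) (k : nat).

Definition small_walk (w : seq int) : Prop :=
  forall s, s \in w -> s \in [:: -1; 0; 1].

(** The walk started at height h and reflected at 0.  For small steps and h >= 0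
    only a down-step at height 0 is reflected; negating it, rather than
    replacing it by 1, makes the absolute values of the steps invariant for
    arbitrary integer steps. *)
Fixpoint reflect_walk (h : int) (w : seq int) : seq int :=
  if w is s :: w' then
    (if h + s < 0 then - s else s) :: reflect_walk (Num.max 0 (h + s)) w'
  else [::].

(** The Lindley recursion: for h = 0, the height of the end of w above its
    minimal position. *)
Definition level (h : int) (w : seq int) : int :=
  foldl (fun h s => Num.max 0 (h + s)) h w.

(** The same path traversed from its end to its start. *)
Definition time_reversal (w : seq int) : seq int := rev (map -%R w).

Lemma small_stepE s : (s \in [:: -1; 0; 1]) = (`|s| <= 1).
Proof. by rewrite !inE; lia. Qed.

Lemma time_reversalK : involutive time_reversal.
Proof.
move=> w; rewrite /time_reversal map_rev revK -map_comp map_id_in //.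
by move=> s _ /=; rewrite opprK.
Qed.

Lemma time_reversal_cons s w :
  time_reversal (s :: w) = rcons (time_reversal w) (- s).
Proof. by rewrite /time_reversal /= rev_cons. Qed.

Lemma time_reversal_rcons w s :
  time_reversal (rcons w s) = - s :: time_reversal w.
Proof. by rewrite /time_reversal map_rcons rev_rcons. Qed.

Lemma size_time_reversal w : size (time_reversal w) = size w.
Proof. by rewrite size_rev size_map. Qed.

Lemma nth_time_reversal w k : (k < size w)%N ->
  (time_reversal w)`_k = - w`_(size w - k.+1).
Proof.
move=> lekw; rewrite nth_rev size_map // (nth_map 0) // ltn_subrL.
exact: leq_ltn_trans lekw.
Qed.

Lemma mem_time_reversal w s : (s \in time_reversal w) = (- s \in w).
Proof. by rewrite mem_rev -{1}[s]opprK mem_map //; exact: oppr_inj. Qed.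

Lemma small_time_reversal v : small_walk v -> small_walk (time_reversal v).
Proof.
by move=> sv s; rewrite mem_time_reversal => /sv; rewrite !inE; lia.
Qed.

Lemma sum_time_reversal v :
  \sum_(s <- time_reversal v) s = - \sum_(s <- v) s.
Proof. by rewrite /time_reversal big_rev /= big_map -sumrN. Qed.

Lemma size_reflect h w : size (reflect_walk h w) = size w.
Proof. by elim: w h => //= s w IH h; rewrite IH. Qed.

Lemma level_rcons h w s : level h (rcons w s) = Num.max 0 (level h w + s).
Proof. by rewrite /level -cats1 foldl_cat. Qed.

Lemma reflect_rcons h w s :
  reflect_walk h (rcons w s) =
    rcons (reflect_walk h w) (if level h w + s < 0 then - s else s).
Proof. by elim: w h => //= t w IH h; rewrite IH. Qed.

Lemma take_reflect h w k :
  take k (reflect_walk h w) = reflect_walk h (take k w).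
Proof. by elim: w h k => [|s w IH] h [|k] //=; rewrite IH. Qed.

Lemma nth_reflect h w k : (k < size w)%N ->
  (reflect_walk h w)`_k =
    if level h (take k w) + w`_k < 0 then - w`_k else w`_k.
Proof. by elim: w h k => [|s w IH] h [|k] //= lekw; rewrite IH. Qed.

Lemma level_ge0 h w : 0 <= h -> 0 <= level h w.
Proof. by elim: w h => //= s w IH h h0; apply: IH; lia. Qed.

Lemma small_walk_cons s w :
  small_walk (s :: w) <-> s \in [:: -1; 0; 1] /\ small_walk w.
Proof.
split=> [sw | [ss sw] t]; last by rewrite inE => /predU1P[-> | /sw].
by split=> [|t tw]; apply: sw; rewrite inE ?eqxx // tw orbT.
Qed.

Lemma small_walk_nth w k : small_walk w -> w`_k \in [:: -1; 0; 1].
Proof.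
have [lekw sw | lewk _] := ltnP k (size w); last by rewrite nth_default.
by apply: sw; exact: mem_nth.
Qed.

Lemma norm_reflect h w k : `|(reflect_walk h w)`_k| = `|w`_k|.
Proof.
have [lekw | lewk] := ltnP k (size w).
  by rewrite nth_reflect //; case: ifP; rewrite ?normrN.
by rewrite !nth_default ?size_reflect.
Qed.

Lemma small_reflect h w : small_walk w -> small_walk (reflect_walk h w).
Proof.
move=> sw s /(nthP 0)[k _ <-]; rewrite small_stepE norm_reflect -small_stepE.
exact: small_walk_nth.
Qed.

(** If the step is reflected then h = 0 and s = -1, so that t = 1, h' = 0, and
    - t is reflected in turn; otherwise h' - t = h >= 0 and it is not. *)
Lemma reflect_stepK (h s : int) (t := if h + s < 0 then - s else s)
    (h' := Num.max 0 (h + s)) :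
  0 <= h -> s \in [:: -1; 0; 1] ->
  - (if h' - t < 0 then - - t else - t) = s /\ Num.max 0 (h' - t) = h.
Proof.
rewrite {}/t {}/h' !inE => h0 ss.
by case: (ltP (h + s)) => hs; split; try case: ifP; lia.
Qed.

(** Passing from (h, w) to (F, v) is an involution.  For w started at level 0 this
    yields the injectivity of Phi, for the time reversal of a nonnegative walk
    its surjectivity. *)
Lemma reflect_time_reversal h w (F := level h w)
    (v := time_reversal (reflect_walk h w)) :
  0 <= h -> small_walk w ->
  time_reversal (reflect_walk F v) = w /\ level F v = h.
Proof.
rewrite {}/F {}/v; elim: w h => [|s w IH] h h0 //= /small_walk_cons[ss sw].
have [|IHw IHh] := IH (Num.max 0 (h + s)) _ sw; first by lia.
rewrite time_reversal_cons reflect_rcons level_rcons.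
rewrite IHh time_reversal_rcons IHw.
by have [-> ->] := reflect_stepK h0 ss.
Qed.

(** Each reflection raises the level by 1 above what the steps of w give, and the
    sum of the steps by 2: with r reflections, level h w = h + sum w + r, and
    the reflected steps have sum sum w + 2 r. *)
Lemma sum_reflect h w : 0 <= h -> small_walk w ->
  \sum_(s <- reflect_walk h w) s = 2 * (level h w - h) - \sum_(s <- w) s.
Proof.
elim: w h => [|s w IH] h h0 /=; first by rewrite !big_nil; lia.
move=> /small_walk_cons[+ sw]; rewrite !big_cons IH ?le_max ?lexx // !inE => ss.
move: (level _ w) => F; clear IH.
by move: (\sum_(j <- w) j) => B; case: (ltP (h + s)) => hs; lia.
Qed.

Lemma level_ge_sum h w : h + \sum_(s <- w) s <= level h w.
Proof.
elim: w h => [|s w IH] h /=; first by rewrite big_nil; lia.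
rewrite big_cons; have := IH (Num.max 0 (h + s)).
by move: (\sum_(j <- w) j) => B; lia.
Qed.

(** Backwards along v, every step changes the level as it changes the position,
    unless the level is cut off at 0, where it cannot exceed a nonnegative
    position. *)
Lemma level_time_reversal_le h q v :
  (forall k, (k <= size v)%N -> 0 <= q + position v k) ->
  h <= q + endpoint v -> level h (time_reversal v) <= q.
Proof.
rewrite /endpoint /position; elim: v q => [|t v IH] q q0 /=.
  by rewrite big_nil addr0.
rewrite big_cons take_size => hq; rewrite time_reversal_cons level_rcons.
have := q0 0%N isT; rewrite big_nil.
suff: level h (time_reversal v) <= q + t by lia.
apply: IH => [k lekv|]; last by rewrite take_size -addrA.
by have := q0 k.+1 lekv; rewrite /= big_cons addrA.
Qed.

(** * The one-dimensional map as a reflection *)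

Lemma position0 (V : zmodType) (w : seq V) : position w 0 = 0.
Proof. by rewrite /position take0 big_nil. Qed.

Lemma positionS (w : seq int) k : (k < size w)%N ->
  position w k.+1 = position w k + w`_k.
Proof. by move=> lekw; rewrite /position (take_nth 0) // big_rcons. Qed.

Lemma take_positions (w : seq int) k : (k <= size w)%N ->
  take k.+1 (positions w) = mkseq (position w) k.+1.
Proof.
by move=> lekw; rewrite /positions /mkseq -map_take take_iota (minn_idPl _).
Qed.

(** A walk with small steps from 0 visits every number between 0 and its minimum;
    the right-hand side compares j with the opposite of the running minimum. *)
Lemma visited_neg w k (j : nat) : small_walk w -> (k <= size w)%N ->
  (- j%:Z \in take k.+1 (positions w)) =
    (j%:Z <= level 0 (take k w) - position w k).
Proof.
move=> sw; elim: k => [|k IH] lekw.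
  by rewrite take_positions // take0 /mkseq /= inE !position0; lia.
have lekw' := ltnW lekw.
rewrite take_positions // mkseqS mem_rcons inE -take_positions // IH //.
rewrite (take_nth 0) // level_rcons positionS //.
have := small_walk_nth k sw; rewrite !inE.
have : 0 <= level 0 (take k w) by exact: level_ge0.
move: (level _ _) (position _ _) w`_k => h p s; lia.
Qed.

Lemma depth_ge w k : (k <= size w)%N -> - position w k <= (depth w)%:Z.
Proof.
move=> lekw; rewrite /depth.
set m := \big[_/_]_(_ <- _) _.
have m0 : m <= 0 by exact: bigmin_le_id.
have : m <= position w k.
  by apply: ge_bigmin_seq => //; apply/mapP; exists k; rewrite // mem_iota.
by lia.
Qed.

Lemma Phi_reflect w : small_walk w -> Phi w = reflect_walk 0 w.
Proof.
move=> sw; apply: (@eq_from_nth _ 0); rewrite size_mkseq ?size_reflect //.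
move=> k lekw; rewrite nth_mkseq // nth_reflect //.
have h0 : 0 <= level 0 (take k w) by exact: level_ge0.
have sk := small_walk_nth k sw; rewrite !inE in sk.
have -> : has (fun j => is_first_down_step w j k) (iota 1 (depth w)) =
          (level 0 (take k w) + w`_k < 0).
  apply/hasP/idP => [[j _ /and3P[/eqP down /eqP reach]]|flip].
    rewrite visited_neg ?(ltnW lekw) //.
    by move: reach; rewrite positionS //; lia.
  have below := level_ge_sum 0 (take k w).
  rewrite -/(position w k) add0r in below.
  have deep := @depth_ge w k.+1 lekw.
  have step := positionS lekw.
  (* The number reached by step k is negative, hence equal to - j for this j. *)
  exists `|position w k.+1|%N; first by rewrite mem_iota; lia.
  rewrite /is_first_down_step visited_neg ?(ltnW lekw) //.
  by apply/and3P; split; lia.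
by case: ifP => //; lia.
Qed.

Lemma size_Phi w : size (Phi w) = size w.
Proof. exact: size_mkseq. Qed.

Lemma norm_nth_Phi w k : `|(Phi w)`_k| = `|w`_k|.
Proof.
have [lekw | lewk] := ltnP k (size w); last by rewrite !nth_default ?size_Phi.
by rewrite nth_mkseq //; case: hasP => // -[j _ /and3P[/eqP-> _ _]].
Qed.

(** * The inverse of the one-dimensional map *)

Definition ends_in_01 (w : seq int) : Prop := endpoint w \in [:: 0; 1].

Definition nonneg_walk (w : seq int) : Prop :=
  forall k, (k <= size w)%N -> 0 <= position w k.

Lemma Phi_nonneg w : small_walk w -> nonneg_walk (Phi w).
Proof.
move=> sw k _; have swk : small_walk (take k w) by move=> s /mem_take/sw.
rewrite Phi_reflect // /position take_reflect sum_reflect //.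
have := level_ge_sum 0 (take k w).
by have := @level_ge0 0 (take k w) (lexx _); lia.
Qed.

(** The inverse of Phi.  The reversed walk starts from the final level of the walk
    to be recovered, which is half the endpoint of v, rounded up. *)
Definition Psi (v : seq int) : seq int :=
  time_reversal (reflect_walk ((endpoint v + 1) %/ 2)%Z (time_reversal v)).

Lemma size_Psi v : size (Psi v) = size v.
Proof. by rewrite size_time_reversal size_reflect size_time_reversal. Qed.

Lemma PhiK w : small_walk w -> ends_in_01 w -> Psi (Phi w) = w.
Proof.
rewrite /ends_in_01 /endpoint /position take_size !inE => sw e01.
rewrite Phi_reflect // /Psi.
suff -> : ((endpoint (reflect_walk 0%R w) + 1) %/ 2)%Z = level 0 w.
  by have [] := reflect_time_reversal (lexx 0) sw.
rewrite /endpoint /position take_size sum_reflect //.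
by move: e01; move: (\sum_(s <- w) s) (level 0 w) => e F; lia.
Qed.

Lemma Psi_small v : small_walk v -> small_walk (Psi v).
Proof.
by move=> sv; apply/small_time_reversal/small_reflect/small_time_reversal.
Qed.

Lemma norm_nth_Psi v k : `|(Psi v)`_k| = `|v`_k|.
Proof.
have [lekv | levk] := ltnP k (size v); last by rewrite !nth_default ?size_Psi.
rewrite /Psi nth_time_reversal ?size_reflect ?size_time_reversal //.
rewrite normrN norm_reflect nth_time_reversal ?normrN; last by lia.
by congr `|_`__|; lia.
Qed.

Lemma level_Psi v : nonneg_walk v ->
  level ((endpoint v + 1) %/ 2)%Z (time_reversal v) = 0.
Proof.
move=> v0; have e0 : 0 <= endpoint v by exact: v0.
apply/eqP; rewrite eq_le level_ge0 ?andbT; last by lia.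
apply: level_time_reversal_le => [k /v0|]; first by rewrite add0r.
by rewrite add0r; lia.
Qed.

Lemma PsiK v : small_walk v -> nonneg_walk v -> Phi (Psi v) = v.
Proof.
move=> sv v0; rewrite Phi_reflect; last exact: Psi_small.
have e0 : 0 <= endpoint v by exact: v0.
have [||+ _] :=
  @reflect_time_reversal ((endpoint v + 1) %/ 2)%Z (time_reversal v).
- by lia.
- exact: small_time_reversal.
by rewrite level_Psi // => /(can_inj time_reversalK).
Qed.

Lemma Psi_ends_in_01 v : small_walk v -> nonneg_walk v -> ends_in_01 (Psi v).
Proof.
move=> sv v0; rewrite /ends_in_01 /endpoint /position take_size /Psi.
have e0 : 0 <= endpoint v by exact: v0.
rewrite sum_time_reversal sum_reflect ?level_Psi ?sum_time_reversal //;
  last 2 first.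
- by lia.
- exact: small_time_reversal.
move: e0; rewrite /endpoint /position take_size !inE.
by move: (\sum_(s <- v) s) => e; lia.
Qed.

End OneDimension.

(** * Coordinates *)

Section Coordinates.
Variable n : nat.
Implicit Types (S : set 'rV[int]_n) (w : seq 'rV[int]_n) (i : 'I_n).
Implicit Types f g : seq int -> seq int.

(** [Phi_coordwise] is convertible to [coordwise Phi]. *)
Definition coordwise f w : seq 'rV[int]_n :=
  mkseq (fun k => \row_(i < n) (f (coord_walk i w))`_k) (size w).

Lemma size_coord_walk i w : size (coord_walk i w) = size w.
Proof. exact: size_map. Qed.

Lemma nth_coord_walk i w k : (coord_walk i w)`_k = w`_k ord0 i.
Proof.
have [lekw | lewk] := ltnP k (size w); first exact: nth_map.
by rewrite !nth_default ?size_map // mxE.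
Qed.

Lemma coord_walk_coordwise f i w : (forall u, size (f u) = size u) ->
  coord_walk i (coordwise f w) = f (coord_walk i w).
Proof.
move=> szf; apply: (@eq_from_nth _ 0).
  by rewrite szf !size_coord_walk size_mkseq.
move=> k; rewrite size_coord_walk size_mkseq => lekw.
by rewrite nth_coord_walk nth_mkseq // mxE.
Qed.

(** The size of the walk and its coordinates determine it; the coordinates alone
    do not when n = 0. *)
Lemma coordwiseK f g w : (forall u, size (f u) = size u) ->
  (forall i, g (f (coord_walk i w)) = coord_walk i w) ->
  coordwise g (coordwise f w) = w.
Proof.
move=> szf gfw; apply: (@eq_from_nth _ 0); rewrite !size_mkseq // => k lekw.
rewrite nth_mkseq ?size_mkseq //; apply/rowP => i.
by rewrite mxE coord_walk_coordwise // gfw nth_coord_walk.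
Qed.

Lemma position_coord i w k : position w k ord0 i = position (coord_walk i w) k.
Proof. by rewrite /position summxE /coord_walk -map_take big_map. Qed.

Lemma endpoint_coord i w : endpoint w ord0 i = endpoint (coord_walk i w).
Proof. by rewrite /endpoint position_coord size_coord_walk. Qed.

(** The coordinates of s where t differs are negated one after the other. *)
Lemma stable_norm S (s t : 'rV[int]_n) :
  (forall i s, S s -> S (reflection i s)) ->
  (forall i, `|t ord0 i| = `|s ord0 i|) -> S s -> S t.
Proof.
move=> S_refl ts Ss.
have Sr (r : seq 'I_n) : S (\row_i (if i \in r then t ord0 i else s ord0 i)).
  elim: r => [|i r IH].
    by rewrite (_ : \row_ _ _ = s) //; apply/rowP => j; rewrite mxE.
  set u := \row_ _ _; set u' := \row_ _ _ in IH.
  have u_u' j : u ord0 j = if j == i then t ord0 j else u' ord0 j.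
    by rewrite !mxE inE; case: eqP.
  have [tu' | tu'] : t ord0 i = u' ord0 i \/ t ord0 i = - u' ord0 i.
  - by rewrite mxE; case: ifP; [left | have := ts i; lia].
  - rewrite (_ : u = u') //; apply/rowP => j.
    by rewrite u_u'; case: eqP => // ->.
  - rewrite (_ : u = reflection i u'); first exact: S_refl.
    by apply/rowP => j; rewrite u_u' [RHS]mxE; case: eqP => // ->.
suff -> : t = \row_i (if i \in enum 'I_n then t ord0 i else s ord0 i).
  exact: Sr.
by apply/rowP => i; rewrite mxE mem_enum.
Qed.

Lemma walks_coordwise S f w :
  (forall i s, S s -> S (reflection i s)) ->
  (forall u k, `|(f u)`_k| = `|u`_k|) ->
  walks S w -> walks S (coordwise f w).
Proof.
move=> S_refl normf Sw _ /mapP[k + ->]; rewrite mem_iota /= => lekw.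
apply: (@stable_norm S w`_k) => // [i|]; last by apply: Sw; exact: mem_nth.
by rewrite mxE normf nth_coord_walk.
Qed.

Lemma small_coord_walk S i w :
  S `<=` small_steps n -> walks S w -> small_walk (coord_walk i w).
Proof. by move=> Ssmall Sw _ /mapP[s /Sw /Ssmall + ->]; apply. Qed.

Lemma orthantP w :
  (forall p, p \in positions w -> forall i, 0 <= p ord0 i) <->
  (forall i, nonneg_walk (coord_walk i w)).
Proof.
split=> [w0 i k | w0 _ /mapP[k + ->] i].
  rewrite size_coord_walk -position_coord => lekw; apply: w0.
  by apply/mapP; exists k; rewrite // mem_iota.
rewrite mem_iota /= position_coord => lekw.
by apply: w0; rewrite size_coord_walk.
Qed.

End Coordinates.

Theorem theorem2 (n : nat) (S : set 'rV[int]_n)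
    (S_small : S `<=` small_steps n)
    (S_refl : forall (i : 'I_n) (s : 'rV[int]_n), S s -> S (reflection i s)) :
  [/\ set_bij (walks_ending_in_01 S) (walks_in_orthant S) (@Phi_coordwise n),
      forall w : seq 'rV[int]_n,
        walks_ending_in_01 S w -> size (Phi_coordwise w) = size w
    & forall (w : seq 'rV[int]_n) (i : 'I_n),
        walks_ending_in_01 S w ->
        coord_walk i (Phi_coordwise w) = Phi (coord_walk i w)].
Proof.
have small := fun i w => @small_coord_walk n S i w S_small.
have PhiE (i : 'I_n) w : coord_walk i (Phi_coordwise w) = Phi (coord_walk i w).
  exact: coord_walk_coordwise size_Phi.
have K w : walks_ending_in_01 S w -> coordwise Psi (Phi_coordwise w) = w.
  move=> [Sw e01]; apply: (coordwiseK size_Phi) => i.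
  by apply: PhiK; [exact: small | rewrite /ends_in_01 -endpoint_coord].
split=> [|w _|w i _]; [|exact: size_mkseq|exact: PhiE].
split.
- move=> w [Sw _]; split.
    exact: (walks_coordwise S_refl norm_nth_Phi).
  by apply/orthantP => i; rewrite PhiE; apply/Phi_nonneg/small.
- by move=> w1 w2 /set_mem/K{2}<- /set_mem/K{2}<- ->.
- move=> v [Sv /orthantP v0]; exists (coordwise Psi v).
    split=> [|i]; first exact: (walks_coordwise S_refl norm_nth_Psi).
    rewrite endpoint_coord (coord_walk_coordwise _ _ size_Psi).
    exact: Psi_ends_in_01 (small _ _ Sv) (v0 i).
  by apply: (coordwiseK size_Psi) => i; apply: PsiK => //; exact: small.
Qed.
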